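(* Let nine points $\mathbf{b}_{i0}\in\mathbb{R}^3$, $i=0,1,2,3,4$, and $\mathbf{b}_{i4}\in\mathbb{R}^3$, $i=0,1,3,4$, be given. The bi-quartic Bézier surface $$\mathbf{x}(u,v)=\sum_{i=0}^4\sum_{j=0}^4\mathbf{b}_{ij}B_i^4(u)B_j^4(v)$$ having these nine points among its control points is harmonic if and only if its remaining sixteen control points satisfy $$\begin{array}{rcl} \mathbf{b}_{01}&=&(25\mathbf{b}_{00}+8\mathbf{b}_{04}-40\mathbf{b}_{10}-8\mathbf{b}_{14}+36\mathbf{b}_{20}-16\mathbf{b}_{30}+4\mathbf{b}_{34}+4\mathbf{b}_{40}-\mathbf{b}_{44})/12,\\ \mathbf{b}_{41}&=&(4\mathbf{b}_{00}-\mathbf{b}_{04}-16\mathbf{b}_{10}+4\mathbf{b}_{14}+36\mathbf{b}_{20}-40\mathbf{b}_{30}-8\mathbf{b}_{34}+25\mathbf{b}_{40}+8\mathbf{b}_{44})/12,\\ \mathbf{b}_{11}&=&(17\mathbf{b}_{00}+7\mathbf{b}_{04}-14\mathbf{b}_{10}-4\mathbf{b}_{14}+18\mathbf{b}_{20}-8\mathbf{b}_{30}+2\mathbf{b}_{34}+5\mathbf{b}_{40}+\mathbf{b}_{44})/24,\\ \mathbf{b}_{31}&=&(5\mathbf{b}_{00}+\mathbf{b}_{04}-8\mathbf{b}_{10}+2\mathbf{b}_{14}+18\mathbf{b}_{20}-14\mathbf{b}_{30}-4\mathbf{b}_{34}+17\mathbf{b}_{40}+7\mathbf{b}_{44})/24,\\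 \mathbf{b}_{02}&=&(13\mathbf{b}_{00}+8\mathbf{b}_{04}-28\mathbf{b}_{10}-8\mathbf{b}_{14}+30\mathbf{b}_{20}-16\mathbf{b}_{30}+4\mathbf{b}_{34}+4\mathbf{b}_{40}-\mathbf{b}_{44})/6,\\ \mathbf{b}_{42}&=&(4\mathbf{b}_{00}-\mathbf{b}_{04}-16\mathbf{b}_{10}+4\mathbf{b}_{14}+30\mathbf{b}_{20}-28\mathbf{b}_{30}-8\mathbf{b}_{34}+13\mathbf{b}_{40}+8\mathbf{b}_{44})/6,\\ \mathbf{b}_{12}&=&(11\mathbf{b}_{00}+7\mathbf{b}_{04}-20\mathbf{b}_{10}-4\mathbf{b}_{14}+24\mathbf{b}_{20}-14\mathbf{b}_{30}+2\mathbf{b}_{34}+5\mathbf{b}_{40}+\mathbf{b}_{44})/12,\\ \mathbf{b}_{32}&=&(5\mathbf{b}_{00}+\mathbf{b}_{04}-14\mathbf{b}_{10}+2\mathbf{b}_{14}+24\mathbf{b}_{20}-20\mathbf{b}_{30}-4\mathbf{b}_{34}+11\mathbf{b}_{40}+7\mathbf{b}_{44})/12,\\ \mathbf{b}_{03}&=&(14\mathbf{b}_{00}+19\mathbf{b}_{04}-32\mathbf{b}_{10}-16\mathbf{b}_{14}+36\mathbf{b}_{20}-20\mathbf{b}_{30}+8\mathbf{b}_{34}+5\mathbf{b}_{40}-2\mathbf{b}_{44})/12,\\ \mathbf{b}_{43}&=&(5\mathbf{b}_{00}-2\mathbf{b}_{04}-20\mathbf{b}_{10}+8\mathbf{b}_{14}+36\mathbf{b}_{20}-32\mathbf{b}_{30}-16\mathbf{b}_{34}+14\mathbf{b}_{40}+19\mathbf{b}_{44})/12,\\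 \mathbf{b}_{13}&=&(5\mathbf{b}_{00}+7\mathbf{b}_{04}-8\mathbf{b}_{10}-\mathbf{b}_{14}+9\mathbf{b}_{20}-5\mathbf{b}_{30}+2\mathbf{b}_{34}+2\mathbf{b}_{40}+\mathbf{b}_{44})/12,\\ \mathbf{b}_{33}&=&(2\mathbf{b}_{00}+\mathbf{b}_{04}-5\mathbf{b}_{10}+2\mathbf{b}_{14}+9\mathbf{b}_{20}-8\mathbf{b}_{30}-\mathbf{b}_{34}+5\mathbf{b}_{40}+7\mathbf{b}_{44})/12,\\ \mathbf{b}_{21}&=&(3\mathbf{b}_{00}+\mathbf{b}_{04}-4\mathbf{b}_{10}+8\mathbf{b}_{20}-4\mathbf{b}_{30}+3\mathbf{b}_{40}+\mathbf{b}_{44})/8,\\ \mathbf{b}_{22}&=&(7\mathbf{b}_{00}+3\mathbf{b}_{04}-16\mathbf{b}_{10}+24\mathbf{b}_{20}-16\mathbf{b}_{30}+7\mathbf{b}_{40}+3\mathbf{b}_{44})/12,\\ \mathbf{b}_{23}&=&(7\mathbf{b}_{00}+5\mathbf{b}_{04}-16\mathbf{b}_{10}+4\mathbf{b}_{14}+24\mathbf{b}_{20}-16\mathbf{b}_{30}+4\mathbf{b}_{34}+7\mathbf{b}_{40}+5\mathbf{b}_{44})/24,\\ \mathbf{b}_{24}&=&(\mathbf{b}_{00}-\mathbf{b}_{04}-4\mathbf{b}_{10}+4\mathbf{b}_{14}+6\mathbf{b}_{20}-4\mathbf{b}_{30}+4\mathbf{b}_{34}+\mathbf{b}_{40}-\mathbf{b}_{44})/6.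 \end{array}$$
   Context: $B_i^4(t)=\binom{4}{i}t^i(1-t)^{4-i}$, $i=0,\dots,4$, $0\le t\le 1$, are the Bernstein polynomials of degree $4$. A bi-quartic (tensor product) Bézier surface with control points $\mathbf{b}_{ij}\in\mathbb{R}^3$, $i,j=0,\dots,4$, is the map $\mathbf{x}(u,v)=\sum_{i=0}^4\sum_{j=0}^4\mathbf{b}_{ij}B_i^4(u)B_j^4(v)$ on $0\le u,v\le 1$. It is harmonic if $\Delta\mathbf{x}=\mathbf{x}_{uu}+\mathbf{x}_{vv}=0$ identically. *)

(* Defs.v *)
From HB Require Import structures.
From mathcomp Require Import all_boot all_order all_algebra.
From mathcomp Require Import all_classical all_reals all_analysis.

Set Implicit Arguments.
Unset Strict Implicit.
Unset Printing Implicit Defensive.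

Import Order.TTheory GRing.Theory Num.Theory.
Import numFieldNormedType.Exports.

Local Open Scope ring_scope.

Definition bernstein (R : realType) (n i : nat) (t : R) : R :=
  'C(n, i)%:R * t ^+ i * (1 - t) ^+ (n - i).

(* The Bernstein polynomials, hence the surface, are defined on the whole
   plane; the parameter domain [0, 1]^2 is imposed in [harmonic_surface]. *)
Definition bezier_surface (R : realType) (m n : nat)
    (b : 'I_m.+1 -> 'I_n.+1 -> 'rV[R]_3) (u v : R) : 'rV[R]_3 :=
  \sum_(i < m.+1) \sum_(j < n.+1)
    (bernstein m i u * bernstein n j v) *: b i j.

Definition laplacian (R : realType) (x : R -> R -> 'rV[R]_3) (u v : R)
    : 'rV[R]_3 :=
  derive1n 2 (fun s : R => x s v) u + derive1n 2 (fun t : R => x u t) v.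

(* [derive1n] is total and takes two-sided limits; for the polynomial maps
   considered here the derivatives exist everywhere, and on the boundary of the
   square they agree with the one-sided ones. *)
Definition harmonic_surface (R : realType) (x : R -> R -> 'rV[R]_3) : Prop :=
  forall u v : R, 0 <= u <= 1 -> 0 <= v <= 1 -> laplacian x u v = 0.

(* Main.v *)
Require Import Defs.
From HB Require Import structures.
From mathcomp Require Import all_boot all_order all_algebra.
From mathcomp Require Import all_classical all_reals all_analysis.
From mathcomp Require Import ring lra.

Import Order.TTheory GRing.Theory Num.Theory.
Import numFieldNormedType.Exports.

Local Open Scope ring_scope.

(** Compare power-basis coefficients.  Coordinate by coordinate, the Laplacian
    of a Bezier surface is a polynomial in u and v; it vanishes on the unit
    square iff all its coefficients vanish ([bipoly_eq0_on_unit_square]).  The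
    coefficient of t^k in \sum_i F_i B_i^n(t) is 'C(n, k) times the k-th forward
    difference of F at 0 ([coef_bernstein_poly] and [fdiff]), so that, writing
    D k l for the mixed difference of order (k, l) of the control net at its
    corner, the coefficient of u^k v^l in the Laplacian is
      m (m - 1) 'C(m - 2, k) 'C(n, l) D (k + 2) l
        + n (n - 1) 'C(m, k) 'C(n - 2, l) D k (l + 2)
    ([harmonic_bezier_surfaceP], for any bidegree (m, n)).

    In bidegree (4, 4) these equations reduce to sixteen independent ones
    ([biquartic_systemP]): differences of total order at least 5 vanish, and
    six relations hold between those of lower order.  The solutions form a
    nine-dimensional space, the harmonic polynomials of degree at most 4 in
    each variable, spanned by the real and imaginary parts of (u + i v)^d for
    d <= 4.  Differences being integer combinations of the control points, the
    sixteen equations are linear in the b_ij, and solving them for the sixteen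
    points other than the nine given ones yields the stated formulas;
    conversely the formulas satisfy them identically in the nine points. *)

(** * Bernstein polynomials in the power basis *)

Definition bernstein_poly (R : realType) (n i : nat) : {poly R} :=
  'C(n, i)%:R *: ('X^i * (1 - 'X) ^+ (n - i)).

Lemma horner_bernstein_poly (R : realType) (n i : nat) (t : R) :
  (bernstein_poly R n i).[t] = bernstein n i t.
Proof. by rewrite /bernstein !hornerE. Qed.

(** Both sides count the chains of an i-subset of a k-subset of an n-set. *)
Lemma mul_bin_bin (n k i : nat) : (i <= k <= n)%N ->
  ('C(n, i) * 'C(n - i, k - i) = 'C(n, k) * 'C(k, i))%N.
Proof.
move=> /andP[leik lekn].
have pos : (0 < i`! * (k - i)`! * (n - k)`!)%N by rewrite !muln_gt0 !fact_gt0.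
(* Multiplied by i! (k-i)! (n-k)!, both sides equal n!. *)
apply/eqP; rewrite -(eqn_pmul2r pos); apply/eqP.
have E1 := bin_fact lekn; have E2 := bin_fact leik.
have E3 := bin_fact (leq_trans leik lekn).
have E4 : ('C(n - i, k - i) * ((k - i)`! * (n - k)`!) = (n - i)`!)%N.
  have -> : (n - k = n - i - (k - i))%N.
    by rewrite subnBA // subnK // (leq_trans leik).
  by rewrite bin_fact // leq_sub2r.
transitivity n`!.
  by rewrite -E3 -E4; ring.
by rewrite -E1 -E2; ring.
Qed.

Lemma coef_1subX_exp (R : realType) (n k : nat) :
  ((1 - 'X) ^+ n : {poly R})`_k = (-1) ^+ k * 'C(n, k)%:R.
Proof.
have -> : (1 - 'X) ^+ n = \poly_(i < n.+1) ((-1) ^+ i * 'C(n, i)%:R) :> {poly R}.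
  rewrite exprBn poly_def; apply: eq_bigr => i _.
  rewrite expr1n mulr1 -mul_polyC rmorphM rmorphXn rmorphN1 rmorph_nat.
  by rewrite mulrAC mulr_natr.
rewrite coef_poly ltnS; case: leqP => // ltnk.
by rewrite bin_small // mulr0.
Qed.

(** The sum k + i, of the same parity as k - i, avoids the truncated
    subtraction; for k outside [i, n] the binomials make both sides vanish. *)
Lemma coef_bernstein_poly (R : realType) (n i k : nat) : (i <= n)%N ->
  (bernstein_poly R n i)`_k = (-1) ^+ (k + i) * ('C(n, k) * 'C(k, i))%:R.
Proof.
move=> lein; rewrite coefZ coefXnM; case: ltnP => [ltki | leik].
  by rewrite mulr0 (bin_small ltki) muln0 mulr0.
rewrite coef_1subX_exp; have [lekn | ltnk] := leqP k n; last first.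
  have ltnk' : (n - i < k - i)%N by rewrite ltn_sub2r // (leq_ltn_trans lein).
  by rewrite (bin_small ltnk) (bin_small ltnk') mul0n !mulr0.
rewrite mulrCA -natrM mul_bin_bin ?leik //; congr (_ * _).
by rewrite -signr_odd oddB // -oddD signr_odd.
Qed.

(** * The Laplacian as a polynomial *)

(** Transfers the analytic derivatives of a polynomial curve to formal ones:
    differentiation of a vector-valued map is coordinatewise. *)
Lemma derive1n_poly (R : realType) m (f : R -> 'rV[R]_m.+1)
    (P : 'I_m.+1 -> {poly R}) (k : nat) :
  (forall t j, f t 0 j = (P j).[t]) ->
  forall t j, derive1n k f t 0 j = (P j)^`(k).[t].
Proof.
move=> fP; elim: k => [|k IHk] t j; first by rewrite derivn0 -fP.
have coordE l : (fun s => derive1n k f s 0 l) = horner (P l)^`(k).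
  by apply/funext => s; exact: IHk.
rewrite derive1nS derive1E derive_mx; last first.
  by apply/derivable_mxP => i l; rewrite (ord1 i) coordE; exact: derivable_horner.
by rewrite mxE coordE -derive1E -derivE -derivnS.
Qed.

(** A nonzero polynomial over an integral domain has fewer roots than its size.
    The map f lets the argument range over constants of a larger domain [S],
    so that the lemma applies to {poly {poly R}} as well. *)
Lemma poly_eq0_on_unit_interval (R : numFieldType) (S : idomainType)
    (f : R -> S) (p : {poly S}) : injective f ->
  (forall t, 0 <= t <= 1 -> p.[f t] = 0) -> p = 0.
Proof.
move=> finj p0; apply: contraTeq isT => /max_poly_roots max.
(* The points 1/(k+1) are enough distinct roots. *)
pose s := [seq f k.+1%:R^-1 | k <- iota 0 (size p)].
have /max : all (root p) s.
  apply/allP => _ /mapP[k _ ->]; apply/rootP/p0.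
  by rewrite invr_ge0 ler0n invf_le1 ?ltr0n // ler1n.
rewrite size_map size_iota ltnn map_inj_uniq ?iota_uniq => [/(_ isT) //|k l].
by move=> /finj/invr_inj/eqP; rewrite eqr_nat => /eqP[].
Qed.

Lemma bipoly_eq0_on_unit_square (R : numFieldType) (p : {poly {poly R}}) :
  (forall u v, 0 <= u <= 1 -> 0 <= v <= 1 -> p.[u%:P].[v] = 0) -> p = 0.
Proof.
move=> p0; apply: (poly_eq0_on_unit_interval _ _ _ _ (@polyC_inj R)) => u u01.
by apply: (poly_eq0_on_unit_interval _ _ id) => // v v01; exact: p0.
Qed.

Lemma laplacian_bezier_surface (R : realType) m n
    (b : 'I_m.+1 -> 'I_n.+1 -> 'rV[R]_3) u v :
  laplacian (bezier_surface b) u v = \sum_(i < m.+1) \sum_(j < n.+1)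
    ((bernstein_poly R m i)^`(2).[u] * (bernstein_poly R n j).[v] +
     (bernstein_poly R m i).[u] * (bernstein_poly R n j)^`(2).[v]) *: b i j.
Proof.
pose P c := \sum_(i < m.+1) \sum_(j < n.+1)
  ((bernstein_poly R n j).[v] * b i j 0 c) *: bernstein_poly R m i.
pose Q c := \sum_(i < m.+1) \sum_(j < n.+1)
  ((bernstein_poly R m i).[u] * b i j 0 c) *: bernstein_poly R n j.
have PE t c : bezier_surface b t v 0 c = (P c).[t].
  rewrite summxE horner_sum; apply: eq_bigr => i _.
  rewrite summxE horner_sum; apply: eq_bigr => j _.
  by rewrite mxE hornerZ !horner_bernstein_poly; ring.
have QE t c : bezier_surface b u t 0 c = (Q c).[t].
  rewrite summxE horner_sum; apply: eq_bigr => i _.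
  rewrite summxE horner_sum; apply: eq_bigr => j _.
  by rewrite mxE hornerZ !horner_bernstein_poly; ring.
apply/rowP => c.
have PE2 := derive1n_poly _ _ (fun s => bezier_surface b s v) P 2 PE u c.
have QE2 := derive1n_poly _ _ (bezier_surface b u) Q 2 QE v c.
transitivity ((P c)^`(2).[u] + (Q c)^`(2).[v]).
  by rewrite -PE2 -QE2 mxE.
rewrite !linear_sum !horner_sum -big_split summxE; apply: eq_bigr => i _.
rewrite !linear_sum !horner_sum -big_split summxE; apply: eq_bigr => j _.
by rewrite !linearZ !hornerZ mxE /=; ring.
Qed.

(** * Harmonicity in terms of forward differences *)

(** The k-th forward difference of F at 0, for k < n.  For k >= n the sum is
    truncated, but it then always occurs with a vanishing binomial factor. *)
Definition fdiff {R : pzRingType} {n} (k : nat) (F : 'I_n -> R) : R :=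
  \sum_(i < n) (-1) ^+ (k + i) * 'C(k, i)%:R * F i.

(** The equation at (k, l) is the vanishing of the coefficient of u^k v^l in
    the Laplacian.  The factor m (m - 1) 'C(m - 2, k) comes from
    (k + 2) (k + 1) 'C(m, k + 2), and likewise for n and l. *)
Lemma harmonic_bezier_surfaceP (R : realType) m n
    (b : 'I_m.+1 -> 'I_n.+1 -> 'rV[R]_3) :
  harmonic_surface (bezier_surface b) <->
  forall c, forall k l : nat,
    (m * m.-1 * 'C(m.-2, k) * 'C(n, l))%:R *
      fdiff k.+2 (fun i => fdiff l (fun j => b i j 0 c)) +
    (n * n.-1 * 'C(m, k) * 'C(n.-2, l))%:R *
      fdiff k (fun i => fdiff l.+2 (fun j => b i j 0 c)) = 0.
Proof.
pose B := bernstein_poly R.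
(* The c-th coordinate of the Laplacian, as a polynomial in u over {poly R},
   the coefficients being polynomials in v. *)
pose P c := \sum_(i < m.+1) \sum_(j < n.+1) (b i j 0 c)%:P%:P *
  ((B m i)^`(2)^:P * (B n j)%:P + (B m i)^:P * (B n j)^`(2)%:P) : {poly {poly R}}.
have PE u v c : (P c).[u%:P].[v] = laplacian (bezier_surface b) u v 0 c.
  rewrite laplacian_bezier_surface summxE !horner_sum; apply: eq_bigr => i _.
  rewrite summxE !horner_sum; apply: eq_bigr => j _.
  by rewrite mxE !hornerE !horner_map !hornerE mulrC.
have B2E d i k : (i <= d)%N -> (B d i)^`(2)`_k =
    (-1) ^+ (k + i) * (d * d.-1 * 'C(d.-2, k) * 'C(k.+2, i))%:R.
  move=> leid; rewrite coef_derivn coef_bernstein_poly //.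
  rewrite -mulrnAr -mulrnA !addSn !exprS !mulN1r opprK; congr (_ * _%:R).
  rewrite add0n -(mulnA d) mul_bin_diag mulnCA mul_bin_diag.
  by rewrite !ffactnSr ffactn0 subn1 subn0 /=; ring.
have PcoefE c k l : (P c)`_k`_l =
    (m * m.-1 * 'C(m.-2, k) * 'C(n, l))%:R *
      fdiff k.+2 (fun i => fdiff l (fun j => b i j 0 c)) +
    (n * n.-1 * 'C(m, k) * 'C(n.-2, l))%:R *
      fdiff k (fun i => fdiff l.+2 (fun j => b i j 0 c)).
  rewrite !coef_sum !mulr_sumr -big_split; apply: eq_bigr => i _.
  rewrite !coef_sum !mulr_sumr -big_split; apply: eq_bigr => j _ /=.
  have leim : (i <= m)%N by rewrite -ltnS.
  have lejn : (j <= n)%N by rewrite -ltnS.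
  rewrite coefCM coefD !coefMC !coef_map /=.
  rewrite coefCM coefD !coefCM.
  rewrite !(B2E _ _ _ leim) !(B2E _ _ _ lejn).
  rewrite !(coef_bernstein_poly _ _ _ _ leim).
  rewrite !(coef_bernstein_poly _ _ _ _ lejn).
  rewrite !addSn !exprS.
  by ring.
split=> [h c k l | h u v _ _].
  rewrite -PcoefE (bipoly_eq0_on_unit_square _ (P c)) ?coef0 // => u v u01 v01.
  by rewrite PE h // mxE.
apply/rowP => c; rewrite [RHS]mxE -PE; suff -> : P c = 0 by rewrite !horner0.
by apply/polyP => k; apply/polyP => l; rewrite PcoefE h !coef0.
Qed.

(** * The bidegree (4, 4) *)

(** The summand takes the index both as a number and as an ordinal, so that
    coefficients get evaluated at literal numbers while the elements of 'I_5
    appear as the ring numerals of Z/5. *)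
Lemma sum_ord5 (V : nmodType) (G : nat -> 'I_5 -> V) :
  \sum_(i < 5) G i i = G 0%N 0 + G 1%N 1 + G 2%N 2 + G 3%N 3 + G 4%N 4.
Proof.
rewrite 5!big_ord_recr big_ord0 /= add0r.
by do 4?[congr (_ + _)]; congr (G _ _); apply: val_inj.
Qed.

Lemma fdiff5E (R : pzRingType) (F : 'I_5 -> R) :
  (fdiff 0 F = F 0) * (fdiff 1 F = - F 0 + F 1) *
  (fdiff 2 F = F 0 - 2 * F 1 + F 2) *
  (fdiff 3 F = - F 0 + 3 * F 1 - 3 * F 2 + F 3) *
  (fdiff 4 F = F 0 - 4 * F 1 + 6 * F 2 - 4 * F 3 + F 4).
Proof.
have sgn n : (-1) ^+ n = if odd n then -1 else 1 :> R.
  by rewrite -signr_odd; case: odd.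
do !split;
  rewrite /fdiff (sum_ord5 _
    (fun i I => (-1) ^+ (_ + i) * 'C(_, i)%:R * F I)) !sgn /=;
  rewrite ?(mulN1r, mul1r) ?bin0 ?binn ?mul1r ?mulNr ?mul1r;
  by rewrite ?(mul0r, oppr0, addr0).
Qed.

(** The six equations with k + l <= 2 of [biquartic_systemP], freed of common
    factors; the others say that D vanishes in total order 5 to 8. *)
Definition biquartic_system (R : pzRingType) (D : nat -> nat -> R) : Prop :=
  [/\ [/\ D 2%N 0%N + D 0%N 2%N = 0, D 3%N 1%N + D 1%N 3%N = 0,
          D 3%N 0%N + 2 * D 1%N 2%N = 0, 2 * D 2%N 1%N + D 0%N 3%N = 0 &
          D 4%N 0%N + 6 * D 2%N 2%N = 0 /\ 6 * D 2%N 2%N + D 0%N 4%N = 0],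
      [/\ D 4%N 1%N = 0, D 1%N 4%N = 0, D 3%N 2%N = 0 & D 2%N 3%N = 0] &
      [/\ D 4%N 2%N = 0, D 2%N 4%N = 0, D 3%N 3%N = 0 &
          [/\ D 4%N 3%N = 0, D 3%N 4%N = 0 & D 4%N 4%N = 0]]].

(** When k or l is at least 3 one of the two terms drops out, since 'C(2, k) or
    'C(2, l) is zero; this kills D 3 2, D 2 3 and all higher entries, after
    which the equations at (2, 1) and (1, 2) give D 4 1 = D 1 4 = 0. *)
Lemma biquartic_systemP (R : realFieldType) (D : nat -> nat -> R) :
  (forall k l, (4 * 3 * 'C(2, k) * 'C(4, l))%:R * D k.+2 l +
               (4 * 3 * 'C(4, k) * 'C(2, l))%:R * D k l.+2 = 0) <->
  biquartic_system R D.
Proof.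
have C2 : ('C(2, 0) = 1%N) * ('C(2, 1) = 2%N) * ('C(2, 2) = 1%N) *
  (forall k, 'C(2, k.+3) = 0%N) by [].
have C4 : ('C(4, 0) = 1%N) * ('C(4, 1) = 4%N) * ('C(4, 2) = 6%N) *
  ('C(4, 3) = 4%N) * ('C(4, 4) = 1%N) * (forall k, 'C(4, k.+4.+1) = 0%N) by [].
split=> [h | [[? ? ? ? [? ?]] [? ? ? ?] [? ? ? [? ? ?]]] k l].
  rewrite /biquartic_system.
  move: (h 0%N 0%N) (h 1%N 0%N) (h 2%N 0%N) (h 0%N 1%N) (h 1%N 1%N).
  move: (h 2%N 1%N) (h 0%N 2%N).
  move: (h 1%N 2%N) (h 2%N 2%N) (h 0%N 3%N) (h 1%N 3%N) (h 2%N 3%N).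
  move: (h 1%N 4%N) (h 2%N 4%N) (h 3%N 0%N) (h 4%N 0%N).
  rewrite !C2 !C4 !natrM.
  (* Variables are cheaper for linear arithmetic than applications. *)
  repeat match goal with |- context [D ?i ?j] => generalize (D i j) end.
  by move=> *; do !split; lra.
case: k => [|[|[|[|[|k]]]]]; case: l => [|[|[|[|[|l]]]]];
  rewrite !C2 !C4 !natrM; lra.
Qed.

(** Applied repeatedly, it turns a conjunction of vector equations into one
    conjunction of scalar equations for each coordinate. *)
Lemma rowvec_eq_andP (R : Type) n (u v : 'rV[R]_n)
    (Q : Prop) (q : 'I_n -> Prop) :
  (Q <-> forall c, q c) ->
  (u = v /\ Q <-> forall c, u 0 c = v 0 c /\ q c).
Proof.
move=> Qq; split=> [[-> /Qq h] c|h]; first by split.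
by split; [apply/rowP => c; case: (h c)|apply/Qq => c; case: (h c)].
Qed.

(* The indices are numerals of 'I_5, i.e. integers modulo 5, so that
   0, 1, 2, 3, 4 denote the ordinals with these values. *)
Theorem lemma1 (R : realType) (b : 'I_5 -> 'I_5 -> 'rV[R]_3) :
  harmonic_surface (bezier_surface b) <->
  (b 0 1 = 12^-1 *:
    (25 *: b 0 0 + 8 *: b 0 4 - 40 *: b 1 0 - 8 *: b 1 4 + 36 *: b 2 0
     - 16 *: b 3 0 + 4 *: b 3 4 + 4 *: b 4 0 - b 4 4) /\
  b 4 1 = 12^-1 *:
    (4 *: b 0 0 - b 0 4 - 16 *: b 1 0 + 4 *: b 1 4 + 36 *: b 2 0
     - 40 *: b 3 0 - 8 *: b 3 4 + 25 *: b 4 0 + 8 *: b 4 4) /\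
  b 1 1 = 24^-1 *:
    (17 *: b 0 0 + 7 *: b 0 4 - 14 *: b 1 0 - 4 *: b 1 4 + 18 *: b 2 0
     - 8 *: b 3 0 + 2 *: b 3 4 + 5 *: b 4 0 + b 4 4) /\
  b 3 1 = 24^-1 *:
    (5 *: b 0 0 + b 0 4 - 8 *: b 1 0 + 2 *: b 1 4 + 18 *: b 2 0
     - 14 *: b 3 0 - 4 *: b 3 4 + 17 *: b 4 0 + 7 *: b 4 4) /\
  b 0 2 = 6^-1 *:
    (13 *: b 0 0 + 8 *: b 0 4 - 28 *: b 1 0 - 8 *: b 1 4 + 30 *: b 2 0
     - 16 *: b 3 0 + 4 *: b 3 4 + 4 *: b 4 0 - b 4 4) /\
  b 4 2 = 6^-1 *:
    (4 *: b 0 0 - b 0 4 - 16 *: b 1 0 + 4 *: b 1 4 + 30 *: b 2 0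
     - 28 *: b 3 0 - 8 *: b 3 4 + 13 *: b 4 0 + 8 *: b 4 4) /\
  b 1 2 = 12^-1 *:
    (11 *: b 0 0 + 7 *: b 0 4 - 20 *: b 1 0 - 4 *: b 1 4 + 24 *: b 2 0
     - 14 *: b 3 0 + 2 *: b 3 4 + 5 *: b 4 0 + b 4 4) /\
  b 3 2 = 12^-1 *:
    (5 *: b 0 0 + b 0 4 - 14 *: b 1 0 + 2 *: b 1 4 + 24 *: b 2 0
     - 20 *: b 3 0 - 4 *: b 3 4 + 11 *: b 4 0 + 7 *: b 4 4) /\
  b 0 3 = 12^-1 *:
    (14 *: b 0 0 + 19 *: b 0 4 - 32 *: b 1 0 - 16 *: b 1 4 + 36 *: b 2 0
     - 20 *: b 3 0 + 8 *: b 3 4 + 5 *: b 4 0 - 2 *: b 4 4) /\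
  b 4 3 = 12^-1 *:
    (5 *: b 0 0 - 2 *: b 0 4 - 20 *: b 1 0 + 8 *: b 1 4 + 36 *: b 2 0
     - 32 *: b 3 0 - 16 *: b 3 4 + 14 *: b 4 0 + 19 *: b 4 4) /\
  b 1 3 = 12^-1 *:
    (5 *: b 0 0 + 7 *: b 0 4 - 8 *: b 1 0 - b 1 4 + 9 *: b 2 0 - 5 *: b 3 0
     + 2 *: b 3 4 + 2 *: b 4 0 + b 4 4) /\
  b 3 3 = 12^-1 *:
    (2 *: b 0 0 + b 0 4 - 5 *: b 1 0 + 2 *: b 1 4 + 9 *: b 2 0 - 8 *: b 3 0
     - b 3 4 + 5 *: b 4 0 + 7 *: b 4 4) /\
  b 2 1 = 8^-1 *:
    (3 *: b 0 0 + b 0 4 - 4 *: b 1 0 + 8 *: b 2 0 - 4 *: b 3 0 + 3 *: b 4 0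
     + b 4 4) /\
  b 2 2 = 12^-1 *:
    (7 *: b 0 0 + 3 *: b 0 4 - 16 *: b 1 0 + 24 *: b 2 0 - 16 *: b 3 0
     + 7 *: b 4 0 + 3 *: b 4 4) /\
  b 2 3 = 24^-1 *:
    (7 *: b 0 0 + 5 *: b 0 4 - 16 *: b 1 0 + 4 *: b 1 4 + 24 *: b 2 0
     - 16 *: b 3 0 + 4 *: b 3 4 + 7 *: b 4 0 + 5 *: b 4 4) /\
  b 2 4 = 6^-1 *:
    (b 0 0 - b 0 4 - 4 *: b 1 0 + 4 *: b 1 4 + 6 *: b 2 0 - 4 *: b 3 0
     + 4 *: b 3 4 + b 4 0 - b 4 4)).
Proof.
rewrite harmonic_bezier_surfaceP.
(* Both sides become statements about each coordinate c separately. *)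
apply: iff_trans; last first.
  apply: iff_sym; do 15!apply: rowvec_eq_andP; apply: iff_sym; exact: rowP.
have forall_iff (p q : 'I_3 -> Prop) :
  (forall c, p c <-> q c) -> ((forall c, p c) <-> (forall c, q c)).
  by move=> pq; split=> h c; apply/pq.
apply: forall_iff => c.
apply: iff_trans (biquartic_systemP R
  (fun k l => fdiff k (fun i => fdiff l (fun j => b i j 0 c)))) _.
rewrite !mxE /biquartic_system !fdiff5E.
(* What remains is linear algebra in the b i j 0 c; with the numerals made
   opaque these are recognised as distinct unknowns without computing in 'I_5. *)
move: (0 : 'I_5) (1 : 'I_5) (2 : 'I_5) (3 : 'I_5) (4 : 'I_5) => i0 i1 i2 i3 i4.
split.
  move=> [[? ? ? ? [? ?]] [? ? ? ?] [? ? ? [? ? ?]]].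
  by do !split; lra.
do 15![case=> ->]; move=> ->.
by do !split; field.
Qed.
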